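(* Let $s\ge2r\ge2$ be integers, let $y=(j,d)\in T_{r,s}$, and put $K=\min\{r,d\}$. In the minimum-augmented trapezoidal lattice $T_{r,s}\sqcup\{\widehat 0\}$ with rank $\widehat\rho(\widehat0)=0$, $\widehat\rho(i,c)=c-i+1$, give the principal interval $[\widehat 0,y]$ the rank $\widehat\rho$. Then $$\mathbb{H}_{[\widehat0,y],\widehat\rho}(q,t)=\sum_{k=j}^{K}\Psi_{k-j,\,d-k}^{\,s-2k}(q,qt).$$ Consequently, every interval of the augmented trapezoidal lattice has a closed Gaussian-binomial $q$-Zeta numerator: for $x=(i,c)\le y=(j,d)$ in $T_{r,s}$ the interval $[x,y]$, with rank normalized to be $0$ at $x$, has numerator $\Phi_{i-j,\,d-c}^{\,s-i-c}(t,q)$; the intervals $[\widehat0,y]$ are given by the displayed formula; and the singleton $[\widehat0,\widehat0]$ has numerator $1$.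
   Context: $q$-Zeta numerator: let $P$ be a finite graded poset with a unique maximum and rank function $\rho:P\to\{0,\dots,H\}$, where $H$ is the maximal rank. For $m\ge 0$ put $A_m(P,\rho;q)=\sum_{x_1\le\cdots\le x_m}q^{\rho(x_1)+\cdots+\rho(x_m)}$ (sum over weak chains in $P$; $A_0=1$). The numerator $\mathbb{H}_{P,\rho}(q,t)$ is the polynomial determined by $\sum_{m\ge 0}A_m(P,\rho;q)t^m=\mathbb{H}_{P,\rho}(q,t)/\prod_{a=0}^{H}(1-q^at)$. Trapezoidal poset: $T_{r,s}=\{(i,c):1\le i\le r,\ i\le c\le s-i\}$, ordered by $(i,c)\le(j,d)\iff i\ge j$ and $c\le d$. The augmented lattice is $T_{r,s}\sqcup\{\widehat0\}$ with $\widehat0$ below every cell. Gaussian binomials: for integers $N,k$, $\genfrac{[}{]}{0pt}{}{N}{k}_q=\prod_{v=1}^{k}\frac{1-q^{N-k+v}}{1-q^v}$ if $0\le k\le N$, and $0$ otherwise (including when $N<0$). For integers $a,b,e\ge0$ with $b\le a+e$, $$\Phi_{a,b}^{e}(X,q)=\sum_{\nu\ge0}X^{\nu}q^{\nu^2}\left(\genfrac{[}{]}{0pt}{}{a}{\nu}_q\genfrac{[}{]}{0pt}{}{b}{\nu}_q-q^{e}\genfrac{[}{]}{0pt}{}{b-e+1}{\nu+1}_q\genfrac{[}{]}{0pt}{}{a+e-1}{\nu-1}_q\right),$$ and $\Psi_{a,b}^{e}(q,t)=1$ if $a=0$, while $\Psi_{a,b}^{e}(q,t)=\Phi_{a,b}^{e}(t,q)+(t-1)\,\Phi_{a-1,b}^{e+1}(qt,q)$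 if $a\ge1$. (So $\Psi(q,qt)$ means the second argument $t$ is replaced by $qt$.) *)

(* Defs.v *)
From HB Require Import structures.
From mathcomp Require Import all_boot all_order all_algebra.

Set Implicit Arguments.
Unset Strict Implicit.
Unset Printing Implicit Defensive.

Import Order.TTheory GRing.Theory Num.Theory.
Local Open Scope ring_scope.

(* The formal variable q is the generator of the field Q(q) = Frac Z[q], in
   which the quotients defining the Gaussian binomials make sense; polynomials
   in t are elements of {poly Fq}, with t = 'X. *)
Definition Fq : fieldType := {fraction {poly int}}.
Definition q : Fq := @FracField.tofrac {poly int} 'X.

Section Numerator.
Variables (disp : Order.disp_t) (T : finPOrderType disp).
Implicit Types (P : {set T}) (rho : T -> nat) (N : {poly Fq}).

Definition weak_chain P m (c : m.-tuple T) : bool :=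
  sorted <=%O c && all (fun x => x \in P) c.

Definition chain_sum P rho (m : nat) : Fq :=
  \sum_(c : m.-tuple T | weak_chain P c) q ^+ (\sum_(x <- c) rho x)%N.

Definition max_rank P rho : nat := \max_(x in P) rho x.

Definition zeta_denominator P rho : {poly Fq} :=
  \prod_(0 <= a < (max_rank P rho).+1) (1 - (q ^+ a) *: 'X).

(* N(t) = (\prod_a (1 - q^a t)) * (\sum_m A_m t^m) as formal power series
   in t, coefficient by coefficient. *)
Definition is_qzeta_numerator P rho N : Prop :=
  forall n, N`_n =
    \sum_(k < n.+1) (zeta_denominator P rho)`_k * chain_sum P rho (n - k).

Lemma qzeta_numerator_uniq P rho N1 N2 :
  is_qzeta_numerator P rho N1 -> is_qzeta_numerator P rho N2 -> N1 = N2.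
Proof. by move=> h1 h2; apply/polyP => n; rewrite h1 h2. Qed.

(* A numerator is a polynomial in both variables: it lies in Z[q][t]. *)
Lemma qzeta_numerator_integral P rho N :
  is_qzeta_numerator P rho N ->
  exists N0 : {poly {poly int}}, N = map_poly (@FracField.tofrac _) N0.
Proof.
pose chz m : {poly int} :=
  \sum_(c : m.-tuple T | weak_chain P c) 'X ^+ (\sum_(x <- c) rho x)%N.
have chE m : chain_sum P rho m = FracField.tofrac (chz m).
  by rewrite /chain_sum /chz rmorph_sum; apply: eq_bigr => c _; rewrite rmorphXn.
pose den : {poly {poly int}} :=
  \prod_(0 <= a < (max_rank P rho).+1) (1 - ('X ^+ a) *: 'X).
have denE : zeta_denominator P rho = map_poly (@FracField.tofrac _) den.
  rewrite /zeta_denominator /den rmorph_prod; apply: eq_bigr => a _.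
  by rewrite rmorphB rmorph1 /= map_polyZ map_polyX /= rmorphXn.
move=> hN; pose g n : {poly int} := \sum_(k < n.+1) den`_k * chz (n - k)%N.
have hg n : N`_n = FracField.tofrac (g n).
  rewrite hN /g rmorph_sum; apply: eq_bigr => k _.
  by rewrite rmorphM denE coef_map chE.
exists (\poly_(n < size N) g n); apply/polyP => n.
rewrite coef_map coef_poly; case: ltnP => [_|le_n]; first exact: hg.
by rewrite nth_default // rmorph0.
Qed.

Definition closed_interval (x y : T) : {set T} :=
  [set z : T | (x <= z)%O && (z <= y)%O].

End Numerator.

Definition in_trapezoid (r s : nat) (p : 'I_r.+1 * 'I_s.+1) : bool :=
  let i : nat := p.1 in let c : nat := p.2 in
  [&& (1 <= i)%N, (i <= r)%N, (i <= c)%N & (c <= s - i)%N].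

Definition trapezoid (r s : nat) : Type :=
  {p : 'I_r.+1 * 'I_s.+1 | in_trapezoid p}.
HB.instance Definition _ r s := SubFinite.on (trapezoid r s).

Definition cell_row r s (x : trapezoid r s) : nat := (val x).1.
Definition cell_col r s (x : trapezoid r s) : nat := (val x).2.

Definition trapezoid_le r s (x y : trapezoid r s) : bool :=
  (cell_row y <= cell_row x)%N && (cell_col x <= cell_col y)%N.

Lemma trapezoid_le_refl r s : reflexive (@trapezoid_le r s).
Proof. by move=> x; rewrite /trapezoid_le !leqnn. Qed.

Lemma trapezoid_le_anti r s : antisymmetric (@trapezoid_le r s).
Proof.
move=> x y /andP[/andP[a b] /andP[c d]].
apply/val_inj/eqP; rewrite -pair_eqE; apply/andP.
by split; rewrite -val_eqE eqn_leq; apply/andP.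
Qed.

Lemma trapezoid_le_trans r s : transitive (@trapezoid_le r s).
Proof.
move=> y x z /andP[a b] /andP[c d]; apply/andP.
by split; [apply: leq_trans c a | apply: leq_trans b d].
Qed.

Fact trapezoid_display : Order.disp_t. Proof. exact: Order.Disp tt tt. Qed.

HB.instance Definition _ r s :=
  Order.Le_isPOrder.Build trapezoid_display (trapezoid r s)
    (@trapezoid_le_refl r s) (@trapezoid_le_anti r s) (@trapezoid_le_trans r s).

Lemma le_trapezoidE r s (x y : trapezoid r s) :
  (x <= y)%O = (cell_row y <= cell_row x)%N && (cell_col x <= cell_col y)%N.
Proof. by []. Qed.

(* None is the adjoined minimum. *)
Definition aug_trapezoid (r s : nat) : Type := option (trapezoid r s).
HB.instance Definition _ r s := Finite.on (aug_trapezoid r s).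

Definition aug_bot {r s} : aug_trapezoid r s := None.
Definition aug_cell r s (x : trapezoid r s) : aug_trapezoid r s := Some x.

Definition aug_le r s (x y : aug_trapezoid r s) : bool :=
  match x, y with
  | None, _ => true
  | Some _, None => false
  | Some x', Some y' => (x' <= y')%O
  end.

Lemma aug_le_refl r s : reflexive (@aug_le r s).
Proof. by case=> //= x; apply: lexx. Qed.

Lemma aug_le_anti r s : antisymmetric (@aug_le r s).
Proof. by case=> [x|] [y|] //= /le_anti ->. Qed.

Lemma aug_le_trans r s : transitive (@aug_le r s).
Proof. by case=> [y|] [x|] [z|] //=; apply: le_trans. Qed.

HB.instance Definition _ r s :=
  Order.Le_isPOrder.Build trapezoid_display (aug_trapezoid r s)
    (@aug_le_refl r s) (@aug_le_anti r s) (@aug_le_trans r s).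

Lemma le_aug_trapezoidE r s (x y : aug_trapezoid r s) : (x <= y)%O = aug_le x y.
Proof. by []. Qed.

(* Cells satisfy cell_row x <= cell_col x, so the subtraction is not truncated. *)
Definition aug_rank r s (x : aug_trapezoid r s) : nat :=
  if x is Some x' then (cell_col x' - cell_row x' + 1)%N else 0%N.

(* N and k range over all integers: negative arguments do occur in Phi. *)
Definition gauss_binom (N k : int) : Fq :=
  if (0 <= k) && (k <= N) then
    \prod_(1 <= v < `|k|%N.+1) ((1 - q ^ (N - k + v%:Z)) / (1 - q ^+ v))
  else 0.

Definition Phi_coef (a b e nu : nat) : Fq :=
  q ^+ (nu ^ 2) *
  (gauss_binom a%:Z nu%:Z * gauss_binom b%:Z nu%:Z
   - q ^+ e * gauss_binom (b%:Z - e%:Z + 1) (nu%:Z + 1)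
            * gauss_binom (a%:Z + e%:Z - 1) (nu%:Z - 1)).

(* All terms with nu > b vanish (Phi_coef_large), so this finite sum is the
   sum over all nu >= 0. *)
Definition Phi (a b e : nat) (X : {poly Fq}) : {poly Fq} :=
  \sum_(0 <= nu < b.+1) Phi_coef a b e nu *: X ^+ nu.

Lemma gauss_binom_large (N k : int) : N < k -> gauss_binom N k = 0.
Proof. by move=> h; rewrite /gauss_binom [k <= N]leNgt h andbF. Qed.

Lemma Phi_coef_large (a b e nu : nat) : (b < nu)%N -> Phi_coef a b e nu = 0.
Proof.
move=> h; have hz : b%:Z < nu%:Z by rewrite ltz_nat.
rewrite /Phi_coef (gauss_binom_large hz) (@gauss_binom_large (b%:Z - e%:Z + 1)).
  by rewrite !(mulr0, mul0r) subr0 mulr0.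
by rewrite ltrD2r; apply: le_lt_trans hz; rewrite gerBl.
Qed.

Definition Psi (a b e : nat) (t : {poly Fq}) : {poly Fq} :=
  if a is a'.+1 then Phi a b e t + (t - 1) * Phi a' b e.+1 (q *: t) else 1.

(* Main.v *)
Require Import Defs.
From HB Require Import structures.
From mathcomp Require Import all_boot all_order all_algebra.
From mathcomp Require Import zify ring.

(* Let G_y be the generating function in t of the weak chains of [x, y], with
   ranks normalized to be 0 at x.  Splitting chains according to whether they
   contain y, and applying inclusion-exclusion to the intervals below the lower
   covers y1, y2 of y, with meet z, gives
     (1 - q^(rho y) t) G_y = G_y1 + G_y2 - G_z.
   Clearing denominators, the numerators satisfy
     H_y = H_y1 + H_y2 - (1 - q^(rho y - 1) t) H_z,
   and H_y = H_y1 if y has a single lower cover y1.  By the q-Pascal rule, Phi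
   satisfies the same recursion in (a, b), the case b = a + e being the one
   with a single lower cover; so does Psi, hence so does the sum over k in the
   theorem.  Induction on the rank of y concludes. *)

Set Implicit Arguments.
Unset Strict Implicit.
Unset Printing Implicit Defensive.

Import Order.TTheory GRing.Theory Num.Theory.
Local Open Scope ring_scope.

(** * Algebraic identities behind the recursions *)

Lemma pascal_frac (F : fieldType) (x y A D : F) : D != 0 -> 1 - y != 0 ->
  A * (1 - x * y) / (D * (1 - y)) = (1 - x) * A / (D * (1 - y)) + x * (A / D).
Proof. by move=> D0 y0; field; rewrite D0 y0. Qed.

(** In the mixed second difference of two products of Pascal sums only the products of the shifted
    terms survive; by the hypotheses both carry the same power of [q], which factors out as [Q]. *)
Lemma mixed_difference (R : comRingType)
    (P P' Q e A B C D xA xB xC xD A' B' C' D' : R) :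
  P * xA * xB = Q * P' -> P * xC * xD = Q * P' ->
  P * ((A + xA * A') * (B + xB * B') - e * (C + xC * C') * (D + xD * D')) =
    P * (A * (B + xB * B') - e * (C + xC * C') * D)
    + P * ((A + xA * A') * B - e * C * (D + xD * D'))
    - P * (A * B - e * C * D) + Q * (P' * (A' * B' - e * C' * D')).
Proof. by move=> E1 E2; ring: E1 E2. Qed.

Lemma Psi_rec_step (R : comRingType) (x y z u x' y' z' v : R) :
  x + y - u * z + v * (x' + y' - u * z')
  = (x + v * x') + (y + v * y') - u * (z + v * z').
Proof. ring. Qed.

(** * Gaussian binomials and the [q]-Pascal rule *)

Lemma q_neq0 : q != 0.
Proof. by rewrite /q tofrac_eq0 polyX_eq0. Qed.

Lemma subr1qX_neq0 n : 1 - q ^+ n.+1 != 0.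
Proof.
rewrite subr_eq0 eq_sym /q -rmorphXn -(rmorph1 (@FracField.tofrac _)) tofrac_eq.
apply/negP => /eqP /(congr1 (fun p : {poly int} => size p)).
by rewrite size_polyXn size_poly1.
Qed.

Lemma gauss_binom_neg (N k : int) : k < 0 -> gauss_binom N k = 0.
Proof. by move=> k0; rewrite /gauss_binom leNgt k0. Qed.

Lemma gauss_binom0 (N : int) : 0 <= N -> gauss_binom N 0 = 1.
Proof. by move=> N0; rewrite /gauss_binom lexx N0 /= big_geq. Qed.

Lemma gauss_binom_nat (c k : nat) :
  gauss_binom (c + k)%:Z k%:Z =
    \prod_(1 <= v < k.+1) ((1 - q ^+ (c + v)) / (1 - q ^+ v)).
Proof.
rewrite /gauss_binom lez_nat leq_addl /=; apply: eq_bigr => v _.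
by have -> : (c + k)%:Z - k%:Z + v%:Z = (c + v)%:Z by lia.
Qed.

Lemma gauss_binom_diag (k : nat) : gauss_binom k%:Z k%:Z = 1.
Proof.
rewrite -[X in gauss_binom X%:Z]add0n gauss_binom_nat big_add1 /= big1 // => v _.
by rewrite add0n divff // subr1qX_neq0.
Qed.

(** The rule fails only at [N = k = 0], where the left side is 1 and both binomials on the right are
    0 by convention. It is an identity of fractions for [0 < k < N]; elsewhere every binomial is 0
    or 1. *)
Lemma gauss_binom_pascal (N k : int) : (N != 0) || (k != 0) ->
  gauss_binom N k = gauss_binom (N - 1) k
                    + q ^ (N - k) * gauss_binom (N - 1) (k - 1).
Proof.
move=> Nk0.
have [k0|k0|k0] := ltgtP k 0.
- by rewrite !gauss_binom_neg ?mulr0 ?addr0 //; lia.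
- have [Nk|Nk|Nk] := ltgtP N k.
  + by rewrite !gauss_binom_large ?mulr0 ?addr0 //; lia.
  + have [n En] : exists n : nat, N - k = n.+1%:Z.
      by exists `|N - k|%N.-1; lia.
    have [l El] : exists l : nat, k = l.+1%:Z by exists `|k|%N.-1; lia.
    have -> : N - 1 = (n + l.+1)%:Z by lia.
    have -> : k - 1 = l%:Z by lia.
    have -> : N = (n.+1 + l.+1)%:Z by lia.
    rewrite El (gauss_binom_nat n.+1 l.+1) (gauss_binom_nat n l.+1).
    rewrite -[(n + l.+1)%N]addSnnS (gauss_binom_nat n.+1 l).
    have -> : (n.+1 + l.+1)%:Z - l.+1%:Z = n.+1%:Z by lia.
    rewrite !prodf_div !(big_add1 _ _ 0) /=.
    rewrite [X in _ = X / _ + _](big_nat_recl l 0) //=.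
    rewrite !(big_nat_recr l 0) //=.
    under [X in _ = (1 - q ^+ _) * X / _ + _]eq_bigr do rewrite addnS -addSn.
    (* All three binomials are [A / D] up to end factors; [pascal_frac] is applied with
       [x = q^(n+1)] and [y = q^(l+1)]. *)
    set A := \prod_(0 <= i < l) (1 - q ^+ (n.+1 + i.+1)).
    set D := \prod_(0 <= i < l) (1 - q ^+ i.+1).
    have D0 : D != 0.
      by rewrite prodf_seq_neq0; apply/allP => i _; rewrite subr1qX_neq0.
    have := subr1qX_neq0 l.
    by rewrite addn1 exprD -exprnP; apply: pascal_frac.
  + subst N; rewrite [gauss_binom (k - 1) k]gauss_binom_large; last by lia.
    have -> : k = `|k|%N%:Z by lia.
    have -> : `|k|%N%:Z - 1 = `|k|%N.-1%:Z by lia.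
    by rewrite !gauss_binom_diag subrr expr0z; ring.
- subst k; rewrite [gauss_binom _ (0 - 1)]gauss_binom_neg // mulr0 addr0.
  have [N0|N0] := ltP N 0; first by rewrite !gauss_binom_large //; lia.
  by rewrite !gauss_binom0 //; lia.
Qed.

(** * Recursions for [Phi] and [Psi] *)

Lemma Phi_coef_rec a b e nu : (b < a + e)%N ->
  Phi_coef a.+1 b.+1 e nu =
    Phi_coef a b.+1 e nu + Phi_coef a.+1 b e nu - Phi_coef a b e nu
    + (if nu is nu'.+1 then q ^+ (a + b).+1 * Phi_coef a b e nu' else 0).
Proof.
move=> hb; rewrite /Phi_coef.
have -> : b.+1%:Z - e%:Z + 1 = (b%:Z - e%:Z + 1) + 1 by lia.
have -> : a.+1%:Z + e%:Z - 1 = (a%:Z + e%:Z - 1) + 1 by lia.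
rewrite (@gauss_binom_pascal a.+1%:Z) // (@gauss_binom_pascal b.+1%:Z) //.
rewrite (@gauss_binom_pascal (b%:Z - e%:Z + 1 + 1)); last by lia.
(* The exception to Pascal's rule would be [a + e = 0] with [nu = 1]; the hypothesis gives
   [a + e > 0]. *)
rewrite (@gauss_binom_pascal (a%:Z + e%:Z - 1 + 1)); last by lia.
rewrite !addrK.
have -> : a.+1%:Z - 1 = a by lia.
have -> : b.+1%:Z - 1 = b by lia.
case: nu => [|nu].
  have neg1 N : gauss_binom N (0%:Z - 1) = 0 by rewrite gauss_binom_neg.
  have neg2 N : gauss_binom N (0%:Z - 1 - 1) = 0 by rewrite gauss_binom_neg.
  by rewrite neg1 neg2 !(mulr0, addr0) addrK.
have -> : nu.+1%:Z - 1 = nu by lia.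
have -> : b%:Z - e%:Z + 1 + 1 - (nu.+1%:Z + 1) = (b%:Z - e%:Z - nu%:Z) by lia.
have -> : nu.+1%:Z = nu%:Z + 1 by lia.
have -> : a.+1%:Z - (nu%:Z + 1) = a%:Z - nu%:Z by lia.
have -> : b.+1%:Z - (nu%:Z + 1) = b%:Z - nu%:Z by lia.
set A := gauss_binom a nu; set B := gauss_binom b nu.
(* Both exponents add up to [nu^2 + a + b + 1], since [(nu+1)^2 - 2 nu = nu^2 + 1] and [e] cancels
   in the second. *)
have E1 : q ^+ (nu.+1 ^ 2) * q ^ (a%:Z - nu%:Z) * q ^ (b%:Z - nu%:Z)
    = q ^+ (a + b).+1 * q ^+ (nu ^ 2).
  rewrite !exprnP -!expfzDr ?q_neq0 //; congr (_ ^ _).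
  by rewrite -!mulnn; lia.
have E2 : q ^+ (nu.+1 ^ 2) * q ^ (b%:Z - e%:Z - nu%:Z) * q ^ (a%:Z + e%:Z - nu%:Z)
    = q ^+ (a + b).+1 * q ^+ (nu ^ 2).
  rewrite !exprnP -!expfzDr ?q_neq0 //; congr (_ ^ _).
  by rewrite -!mulnn; lia.
exact: mixed_difference.
Qed.

(** By Pascal's rule, raising [b] adds the same quantity, with the factor [q^(b+1-nu)], to the first
    product and to the subtracted one. *)
Lemma Phi_coef_boundary a b e nu : (a + e = b.+1)%N ->
  Phi_coef a b.+1 e nu = Phi_coef a b e nu.
Proof.
move=> hb; rewrite /Phi_coef.
have -> : b.+1%:Z - e%:Z + 1 = (a%:Z + 1) by lia.
have -> : b%:Z - e%:Z + 1 = a%:Z by lia.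
have -> : a%:Z + e%:Z - 1 = b%:Z by lia.
rewrite (@gauss_binom_pascal b.+1%:Z) // (@gauss_binom_pascal (a%:Z + 1)); last by lia.
rewrite addrK.
have -> : b.+1%:Z - 1 = b by lia.
have -> : a%:Z + 1 - (nu%:Z + 1) = a%:Z - nu%:Z by lia.
have -> : nu%:Z + 1 - 1 = nu by lia.
have -> : b.+1%:Z - nu%:Z = e%:Z + (a%:Z - nu%:Z) by lia.
rewrite expfzDr ?q_neq0 // -exprnP.
set x := q ^ _; set A := gauss_binom a nu; set B := gauss_binom b (nu%:Z - 1).
congr (_ * _); rewrite mulrDr mulrDr mulrDl opprD addrACA.
rewrite [X in _ + X](_ : _ = 0) ?addr0 //.
by apply/eqP; rewrite subr_eq0; apply/eqP; rewrite [A * _]mulrCA !mulrA.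
Qed.

(** Padding with vanishing terms lets values of [Phi] with different [b] be compared over one
    range. *)
Lemma PhiE n a b e (X : {poly Fq}) : (b < n)%N ->
  Phi a b e X = \sum_(0 <= nu < n) Phi_coef a b e nu *: X ^+ nu.
Proof.
move=> bn; rewrite /Phi [RHS](big_cat_nat (n := b.+1)) //=.
rewrite [X in _ + X]big1_seq ?addr0 // => nu /=.
by rewrite mem_index_iota => /andP[/Phi_coef_large -> _]; rewrite scale0r.
Qed.

Lemma Phi_boundary a b e X : (a + e = b.+1)%N -> Phi a b.+1 e X = Phi a b e X.
Proof.
move=> hb; rewrite !(@PhiE b.+2) //.
by apply: eq_bigr => nu _; rewrite Phi_coef_boundary.
Qed.

Lemma Phi_rec a b e (X : {poly Fq}) : (b < a + e)%N ->
  Phi a.+1 b.+1 e X =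
    Phi a b.+1 e X + Phi a.+1 b e X - (1 - q ^+ (a + b).+1 *: X) * Phi a b e X.
Proof.
move=> hb.
(* Multiplication by [X] shifts the index by one, which accounts for the last summand of
   [Phi_coef_rec]. *)
have shiftE : (q ^+ (a + b).+1 *: X) * Phi a b e X =
    \sum_(0 <= nu < b.+2) (if nu is nu'.+1 then
       q ^+ (a + b).+1 * Phi_coef a b e nu' else 0) *: X ^+ nu.
  rewrite big_nat_recl // scale0r add0r /Phi mulr_sumr; apply: eq_bigr => nu _.
  by rewrite [X ^+ nu.+1]exprS -scalerAl -scalerAr scalerA.
rewrite mulrBl mul1r shiftE !(@PhiE b.+2) // -big_split -!sumrB /=.
apply: eq_bigr => nu _; rewrite -scalerBl -scalerDl -scalerBl Phi_coef_rec //.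
by rewrite opprB addrA addrAC.
Qed.

(** This corresponds to an interval within one row, a chain; [b <= e] kills the subtracted term for
    [nu > 0]. *)
Lemma Phi_0l b e X : (b <= e)%N -> Phi 0 b e X = 1.
Proof.
move=> be; rewrite /Phi big_ltn // big1_seq => [|nu /=].
  rewrite addr0 /Phi_coef expr0 mul1r !gauss_binom0 ?mul1r //.
  by rewrite [gauss_binom _ (0%:Z - 1)]gauss_binom_neg // mulr0 subr0 scale1r.
rewrite mem_index_iota => /andP[nu0 _]; rewrite /Phi_coef.
rewrite (@gauss_binom_large 0%N%:Z) ?(@gauss_binom_large (b%:Z - _ + _)); try lia.
by rewrite !(mul0r, mulr0) subr0 mulr0 scale0r.
Qed.

Lemma Phi_0r a e X : Phi a 0 e X = 1.
Proof.
rewrite /Phi big_nat1 /Phi_coef expr0 mul1r !gauss_binom0 ?mul1r //.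
by rewrite [gauss_binom _ (0%:Z - 1)]gauss_binom_neg // mulr0 subr0 scale1r.
Qed.

Lemma Psi_boundary a b e X : (a + e = b.+1)%N -> Psi a b.+1 e X = Psi a b e X.
Proof.
by case: a => [|a] //= hb; rewrite !Phi_boundary //; lia.
Qed.

Lemma Psi_0r a e X : (0 < a)%N -> Psi a 0 e X = X.
Proof. by case: a => // a _; rewrite /= !Phi_0r mulr1 addrC subrK. Qed.

(** Both [Phi] in [Psi] obey the same linear relation: replacing [a] by [a - 1] and [X] by [q X]
    leaves [q^(a+b+1) X] unchanged. At the bottom value of [a] the second [Phi] is the constant
    1. *)
Lemma Psi_rec a b e (X : {poly Fq}) : (b < a + e)%N ->
  Psi a.+1 b.+1 e X =
    Psi a b.+1 e X + Psi a.+1 b e X - (1 - q ^+ (a + b).+1 *: X) * Psi a b e X.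
Proof.
case: a => [|a] hb /=; rewrite Phi_rec //.
  rewrite !Phi_0l ?mulr1; [|lia..].
  by rewrite addrAC -[1 + _ + _]addrA.
rewrite (@Phi_rec a b e.+1); last by lia.
have -> : q ^+ (a + b).+1 *: (q *: X) = q ^+ (a.+1 + b).+1 *: X.
  by rewrite scalerA -exprSr.
exact: Psi_rec_step.
Qed.

(** * Sums over weak chains *)

Section ChainSum.
Variables (disp : Order.disp_t) (T : finPOrderType disp).
Implicit Types (P A B : {set T}) (rho : T -> nat).

Lemma sorted_le_rcons (s : seq T) x :
  sorted <=%O (rcons s x) = all (fun z => z <= x)%O s && sorted <=%O s.
Proof. by rewrite !(sorted_pairwise le_trans) pairwise_rcons. Qed.

Lemma weak_chain_rcons P m (c : m.-tuple T) y :
  (forall x, x \in P -> (x <= y)%O) -> y \in P ->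
  weak_chain P (rcons_tuple c y) = weak_chain P c.
Proof.
move=> topy Py; rewrite /weak_chain /= all_rcons Py /=.
apply/andP/andP => -[srt cP]; split=> //.
  by move: srt; rewrite (sorted_le_rcons) => /andP[].
rewrite (sorted_le_rcons) srt andbT.
by apply/allP => x xc; apply: topy; apply: (allP cP).
Qed.

Lemma chain_sum0 P rho : chain_sum P rho 0 = 1.
Proof.
rewrite /chain_sum (big_pred1 [tuple]) /= ?big_nil ?expr0 // => c.
by rewrite [c]tuple0; apply/esym/eqP.
Qed.

(** A weak chain containing the maximum [y] ends in [y], and deleting this last entry is a bijection
    onto the chains one shorter. *)
Lemma chain_sum_top P rho y m :
  y \in P -> (forall x, x \in P -> (x <= y)%O) ->
  chain_sum P rho m.+1 =
    chain_sum (P :\ y) rho m.+1 + q ^+ rho y * chain_sum P rho m.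
Proof.
move=> Py topy; rewrite {1}/chain_sum (bigID (fun c : m.+1.-tuple T => y \notin c)) /=.
congr (_ + _).
  apply: eq_bigl => c; rewrite /weak_chain -andbA; congr (_ && _).
  apply/andP/allP => [[/allP cP yc] x xc|cP].
    by rewrite !inE cP // andbT; apply: contraNneq yc => <-.
  split; first by apply/allP => x /cP; rewrite !inE => /andP[].
  by apply/negP => /cP; rewrite !inE eqxx.
rewrite /chain_sum mulr_sumr.
rewrite (reindex_onto (fun c : m.-tuple T => rcons_tuple c y)
           (fun c => belast_tuple (thead c) (behead_tuple c))) /=; last first.
  move=> c /andP[/andP[srt cP]]; rewrite negbK => yc.
  case/tupleP: c srt cP yc => x c /= srt cP yc; apply/val_inj => /=.
  rewrite theadE lastI; congr rcons.
  have lastP : last x c \in P.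
    by case/andP: cP => xP /allP cP; have := mem_last x c; rewrite inE => /predU1P[->|/cP].
  (* The last entry is at most [y] because [y] is the top of [P], and at least [y] because [y]
     occurs in the sorted chain. *)
  apply: le_anti; rewrite topy ?andbT //.
  have {}yc : y \in x :: val c by [].
  have {}srt : sorted <=%O (x :: val c) by [].
  move: yc srt; rewrite lastI mem_rcons inE => /orP[/eqP<- //|yc].
  by rewrite (sorted_le_rcons) => /andP[/allP/(_ _ yc)].
apply: eq_big => [c|c _].
  rewrite weak_chain_rcons // negbK mem_rcons mem_head andbT.
  rewrite andb_idr // => _; apply/eqP/val_inj => /=.
  by case: c => -[|x c] sc //=; rewrite /thead (tnth_nth x) /= ?belast_rcons.
by rewrite -cats1 big_cat big_seq1 /= addnC exprD.
Qed.

(** A weak chain in the union lies in whichever set contains its last entry, as both are down-closed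
    in the union; inclusion-exclusion then holds chain by chain. *)
Lemma chain_sumUI A B rho m :
    (forall x y, (x <= y)%O -> x \in A :|: B -> y \in A -> x \in A) ->
    (forall x y, (x <= y)%O -> x \in A :|: B -> y \in B -> x \in B) ->
  chain_sum (A :|: B) rho m =
    chain_sum A rho m + chain_sum B rho m - chain_sum (A :&: B) rho m.
Proof.
move=> downA downB.
rewrite /chain_sum !(big_mkcond (fun c => weak_chain _ c)) -big_split -sumrB /=.
apply: eq_bigr => c _.
have -> : weak_chain (A :&: B) c = weak_chain A c && weak_chain B c.
  rewrite /weak_chain andbACA andbb; congr (_ && _).
  by rewrite -all_predI; apply: eq_all => x; rewrite /= inE.
have -> : weak_chain (A :|: B) c = weak_chain A c || weak_chain B c.
  rewrite /weak_chain -andb_orr; case: (boolP (sorted _ c)) => //= srt.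
  apply/idP/orP => [|[] /allP cP]; last first.
  - by apply/allP => x xc; rewrite inE cP ?orbT.
  - by apply/allP => x xc; rewrite inE cP.
  (* The empty chain has no last entry to test, but lies in both sets. *)
  case: m c srt => [|m] c; first by rewrite tuple0 /=; left.
  case/tupleP: c => x0 c; rewrite [tval _]lastI => srt.
  set s := belast x0 c in srt *; set z := last x0 c in srt *.
  rewrite all_rcons => /andP[zAB /allP sAB].
  move: srt; rewrite (sorted_le_rcons) => /andP[/allP sz _].
  case/setUP: (zAB) => [zA|zB]; [left|right];
    rewrite all_rcons ?zA ?zB /=; apply/allP => x xs.
  - by apply: downA zA; [apply: sz | apply: sAB].
  - by apply: downB zB; [apply: sz | apply: sAB].
by case: weak_chain; case: weak_chain => /=; ring.
Qed.

End ChainSum.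

(** * Numerators of intervals and the removal of the top element *)

Definition den n : {poly Fq} := \prod_(0 <= a < n) (1 - (q ^+ a) *: 'X).

(** Stands for the product of [D] with the power series of [f], which is never formed; for the full
    denominator and the chain sums it is the right side of [is_qzeta_numerator]. *)
Definition cauchy_coef (D : {poly Fq}) (f : nat -> Fq) n : Fq :=
  \sum_(k < n.+1) D`_k * f (n - k)%N.

Lemma cauchy_coefS D c f n :
  cauchy_coef (D * (1 - c *: 'X)) f n =
  cauchy_coef D f n - (if n is n'.+1 then c * cauchy_coef D f n' else 0).
Proof.
rewrite /cauchy_coef.
under eq_bigr => k _ do
  rewrite mulrBr mulr1 -scalerAr coefB coefZ coefMX mulrBl.
rewrite sumrB; congr (_ - _).
case: n => [|n]; first by rewrite big_ord1 /= mulr0 mul0r.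
rewrite big_ord_recl /= mulr0 mul0r add0r mulr_sumr.
by apply: eq_bigr => k _; rewrite /= mulrA subSS.
Qed.

Lemma denS n : den n.+1 = den n * (1 - q ^+ n *: 'X).
Proof. by rewrite /den big_nat_recr. Qed.

Section IntervalNumerator.
Variables (disp : Order.disp_t) (T : finPOrderType disp).
Implicit Types (P : {set T}) (rho : T -> nat) (x y z : T) (N : {poly Fq}).

(** Series form of [chain_sum_top]: the factor belonging to the top cancels all chains through
    it. *)
Lemma cauchy_coef_top P rho D y n :
  y \in P -> (forall x, x \in P -> (x <= y)%O) ->
  cauchy_coef (D * (1 - q ^+ rho y *: 'X)) (chain_sum P rho) n =
  cauchy_coef D (chain_sum (P :\ y) rho) n.
Proof.
move=> Py topy; rewrite cauchy_coefS /cauchy_coef; case: n => [|n].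
  by rewrite !big_ord1 !chain_sum0 subr0.
(* Length 0 contributes equally to both sides and is split off, since [chain_sum_top] concerns
   positive lengths. *)
rewrite !(big_ord_recr n.+1) /= !subnn !chain_sum0 addrAC; congr (_ + _).
rewrite mulr_sumr -sumrB; apply: eq_bigr => k _.
by rewrite subSn -1?ltnS // (chain_sum_top _ _ Py topy) mulrDr mulrCA addrK.
Qed.

Section Monotone.
Variable rho : T -> nat.
Hypothesis rho_homo : {homo rho : x y / (x <= y)%O >-> (x <= y)%N}.

Lemma max_rank_interval x y : (x <= y)%O ->
  max_rank (closed_interval x y) rho = rho y.
Proof.
move=> xy; apply/anti_leq/andP; split.
  by apply/bigmax_leqP => z; rewrite inE => /andP[_ /rho_homo].
by apply: (@leq_bigmax_cond _ _ rho y); rewrite inE xy lexx.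
Qed.

Lemma interval_numeratorE x y N n : (x <= y)%O ->
  is_qzeta_numerator (closed_interval x y) rho N ->
  N`_n = cauchy_coef (den (rho y).+1) (chain_sum (closed_interval x y) rho) n.
Proof. by move=> xy ->; rewrite /zeta_denominator max_rank_interval. Qed.

Lemma interval_numerator_remove_top x y N : (x <= y)%O ->
  (forall n, N`_n =
     cauchy_coef (den (rho y)) (chain_sum (closed_interval x y :\ y) rho) n) ->
  is_qzeta_numerator (closed_interval x y) rho N.
Proof.
move=> xy NE n; rewrite NE /zeta_denominator max_rank_interval //.
rewrite -[RHS]/(cauchy_coef (den _) _ n) denS cauchy_coef_top //.
  by rewrite inE xy lexx.
by move=> z; rewrite inE => /andP[].
Qed.

Lemma point_numerator x : rho x = 0%N ->
  is_qzeta_numerator (closed_interval x x) rho 1.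
Proof.
move=> rx; apply: interval_numerator_remove_top => // n.
rewrite rx /den big_geq // /cauchy_coef big_ord_recl !coef1 mul1r subn0.
rewrite big1 ?addr0 => [|k _]; last by rewrite coef1 mul0r.
case: n => [|n]; first by rewrite chain_sum0.
rewrite /chain_sum big_pred0 // => c; rewrite /weak_chain.
case/tupleP: c => z c /=; apply/negbTE; rewrite !inE.
by apply/negP => /and3P[_ /andP[/negP zx /le_anti zx'] _]; apply: zx; rewrite -zx'.
Qed.

Lemma single_cover_numerator x y y1 N :
  (x <= y1)%O -> (forall z, (x <= z)%O -> (z < y)%O = (z <= y1)%O) ->
  rho y = (rho y1).+1 ->
  is_qzeta_numerator (closed_interval x y1) rho N ->
  is_qzeta_numerator (closed_interval x y) rho N.
Proof.
move=> xy1 cov ry N1.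
have xy : (x <= y)%O by rewrite ltW // cov.
apply: interval_numerator_remove_top => // n.
rewrite (interval_numeratorE _ xy1 N1) ry; congr (cauchy_coef _ (chain_sum _ _) _).
apply/setP => z; rewrite !inE; case: (boolP (x <= z)%O) => //= xz; last by rewrite andbF.
by rewrite -cov // lt_neqAle.
Qed.

(** Without its top the interval is a union of two, with intersection [[x, z]]. The remaining
    denominator [den k.+2] is that of [N1] and [N2]; [N3] comes with [den k.+1], and [1 - q^(k+1) t]
    supplies the missing factor. *)
Lemma two_cover_numerator x y y1 y2 z k N1 N2 N3 :
    (x <= z)%O ->
    (forall w, (x <= w)%O -> (w < y)%O = (w <= y1)%O || (w <= y2)%O) ->
    (forall w, (x <= w)%O -> (w <= z)%O = (w <= y1)%O && (w <= y2)%O) ->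
    rho z = k -> rho y1 = k.+1 -> rho y2 = k.+1 -> rho y = k.+2 ->
    is_qzeta_numerator (closed_interval x y1) rho N1 ->
    is_qzeta_numerator (closed_interval x y2) rho N2 ->
    is_qzeta_numerator (closed_interval x z) rho N3 ->
  is_qzeta_numerator (closed_interval x y) rho
    (N1 + N2 - (1 - q ^+ k.+1 *: 'X) * N3).
Proof.
move=> xz cov meet rz r1 r2 ry H1 H2 H3.
have /andP[zy1 zy2] : (z <= y1)%O && (z <= y2)%O by rewrite -meet.
have xy1 := le_trans xz zy1; have xy2 := le_trans xz zy2.
have xy : (x <= y)%O by rewrite ltW // cov // xy1.
apply: interval_numerator_remove_top => // n.
have -> : closed_interval x y :\ y = closed_interval x y1 :|: closed_interval x y2.
  apply/setP => w; rewrite !inE.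
  case: (boolP (x <= w)%O) => //= xw; last by rewrite andbF.
  by rewrite -cov // lt_neqAle.
have mE : closed_interval x y1 :&: closed_interval x y2 = closed_interval x z.
  by apply/setP => w; rewrite !inE; case: (boolP (x <= w)%O) => //= xw; rewrite meet.
have down y' w v : (w <= v)%O ->
    w \in closed_interval x y1 :|: closed_interval x y2 ->
    v \in closed_interval x y' -> w \in closed_interval x y'.
  move=> wv; rewrite !inE => wU /andP[_ vy']; rewrite (le_trans wv vy') andbT.
  by case/orP: wU => /andP[].
transitivity (cauchy_coef (den k.+2) (chain_sum (closed_interval x y1) rho) n
   + cauchy_coef (den k.+2) (chain_sum (closed_interval x y2) rho) n
   - cauchy_coef (den k.+2) (chain_sum (closed_interval x z) rho) n).
  rewrite -r1 -(interval_numeratorE _ xy1 H1) r1 -r2 -(interval_numeratorE _ xy2 H2) r2.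
  rewrite denS cauchy_coefS coefB coefD mulrBl mul1r coefB; congr (_ - (_ - _)).
    by rewrite (interval_numeratorE _ xz H3) rz.
  rewrite -scalerAl coefZ coefXM; case: n => [|n]; first by rewrite mulr0.
  by rewrite (interval_numeratorE _ xz H3) rz.
rewrite ry /cauchy_coef -big_split -sumrB; apply: eq_bigr => i _ /=.
by rewrite chain_sumUI; [rewrite mE mulrBr mulrDr | apply: down..].
Qed.

End Monotone.
End IntervalNumerator.

(** * Intervals of the augmented trapezoid *)

Section Cells.
Variables r s : nat.
Implicit Types x y : trapezoid r s.

(** The truncation in [c <= s - i] is harmless because [1 <= i <= c], which allows the additive
    form. *)
Lemma cell_bounds x : [/\ (1 <= cell_row x)%N, (cell_row x <= r)%N,
  (cell_row x <= cell_col x)%N & (cell_col x + cell_row x <= s)%N].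
Proof.
case: x => p xp; rewrite /cell_row /cell_col /=.
by case/and4P: (xp) => *; split=> //; lia.
Qed.

Lemma cell_exists i c : (1 <= i <= r)%N -> (i <= c)%N -> (c + i <= s)%N ->
  exists x : trapezoid r s, cell_row x = i /\ cell_col x = c.
Proof.
move=> ir ic cs.
have hi : (i < r.+1)%N by lia.
have hc : (c < s.+1)%N by lia.
have ht : in_trapezoid (Ordinal hi, Ordinal hc) by rewrite /in_trapezoid /=; lia.
by exists (exist (@in_trapezoid r s) _ ht).
Qed.

Lemma aug_rank_homo : {homo @aug_rank r s : x y / (x <= y)%O >-> (x <= y)%N}.
Proof.
move=> [x|] [y|] //=; rewrite le_aug_trapezoidE /= le_trapezoidE => /andP[].
by have [] := cell_bounds x; have [] := cell_bounds y; lia.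
Qed.

Lemma aug_rankB_homo a :
  {homo (fun x : aug_trapezoid r s => (aug_rank x - a)%N) : x y /
     (x <= y)%O >-> (x <= y)%N}.
Proof. by move=> x y /aug_rank_homo; apply: leq_sub2r. Qed.

Lemma le_aug_cellE x y : (aug_cell x <= aug_cell y)%O =
  (cell_row y <= cell_row x)%N && (cell_col x <= cell_col y)%N.
Proof. by []. Qed.

(** Induction on the rank of [y = (j, d)] above [x]. The arguments [a], [b], [e] of [Phi] satisfy
    [a + e - b = s - j - d], so its boundary case is the edge [j + d = s], where the cell
    [(j + 1, d)] does not exist. *)
Lemma cell_interval_numerator x y : (x <= y)%O ->
  is_qzeta_numerator (closed_interval (aug_cell x) (aug_cell y))
    (fun z => (aug_rank z - aug_rank (aug_cell x))%N)
    (Phi (cell_row x - cell_row y) (cell_col y - cell_col x)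
         (s - cell_row x - cell_col x) 'X).
Proof.
have [n] := ubnP (cell_row x - cell_row y + (cell_col y - cell_col x))%N.
elim: n y => // n IHn y.
have [r1 rr rc cs] := cell_bounds x; have [r1' rr' rc' cs'] := cell_bounds y.
rewrite le_trapezoidE ltnS => le_n /andP[hr hc].
set rho := (fun z => _).
have rhoE z : (x <= z)%O ->
    rho (aug_cell z) = (cell_row x - cell_row z + (cell_col z - cell_col x))%N.
  rewrite le_trapezoidE /rho /=; have := cell_bounds z; lia.
have covE (y1 y2 : trapezoid r s) :
    cell_row y1 = (cell_row y).+1 -> cell_col y1 = cell_col y ->
    cell_row y2 = cell_row y -> (cell_col y2).+1 = cell_col y ->
    forall w, (aug_cell x <= w)%O ->
    (w < aug_cell y)%O = (w <= aug_cell y1)%O || (w <= aug_cell y2)%O.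
  move=> e1 e2 e3 e4 [w|] //; rewrite lt_leAnge !le_aug_cellE; lia.
pose a := (cell_row x - cell_row y)%N; pose b := (cell_col y - cell_col x)%N.
have row_step : (cell_row y < cell_row x)%N ->
    ((cell_col y + cell_row y).+1 <= s)%N ->
    exists y1 : trapezoid r s,
      cell_row y1 = (cell_row y).+1 /\ cell_col y1 = cell_col y.
  by move=> *; apply: cell_exists; lia.
have col_step : (cell_col x < cell_col y)%N -> exists y2 : trapezoid r s,
    cell_row y2 = cell_row y /\ cell_col y2 = (cell_col y).-1.
  by move=> *; apply: cell_exists; lia.
have [ci|ci] := eqVneq (cell_col y) (cell_col x).
  have [ri|ri] := eqVneq (cell_row y) (cell_row x).
    have -> : y = x by apply/le_anti; rewrite !le_trapezoidE ri ci !leqnn.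
    rewrite !subnn Phi_0r; apply: point_numerator; first exact: aug_rankB_homo.
    by rewrite /rho subnn.
  have [||y1 [y1r y1c]] := row_step; [lia..|].
  have xy1 : (x <= y1)%O by rewrite le_trapezoidE; lia.
  apply: (@single_cover_numerator _ _ rho (aug_rankB_homo _) _ _ (aug_cell y1)) => //.
  - case=> [z|] //; rewrite lt_leAnge !le_aug_cellE; lia.
  - by rewrite !rhoE ?le_trapezoidE; lia.
  - have := IHn y1; rewrite ci y1c ci subnn !Phi_0r; apply; [lia|done].
have [|y2 [y2r y2c]] := col_step; [lia..|].
have xy2 : (x <= y2)%O by rewrite le_trapezoidE; lia.
(* Serves the two cases in which only the column can drop: [y] in the row of [x], or [y] on the
   edge. *)
have single : (forall w : trapezoid r s, (x <= w)%O -> (w < y)%O = (w <= y2)%O) ->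
    Phi a b (s - cell_row x - cell_col x) 'X
      = Phi a b.-1 (s - cell_row x - cell_col x) 'X ->
    is_qzeta_numerator (closed_interval (aug_cell x) (aug_cell y)) rho
      (Phi a b (s - cell_row x - cell_col x) 'X).
  move=> cov ->.
  apply: (@single_cover_numerator _ _ rho (aug_rankB_homo _) _ _ (aug_cell y2)) => //.
  - by case=> [z|] // xz; have := cov z xz; rewrite !lt_leAnge.
  - by rewrite !rhoE ?le_trapezoidE; lia.
  - have := IHn y2; rewrite y2r y2c.
    have -> : ((cell_col y).-1 - cell_col x = b.-1)%N by rewrite /b; lia.
    by apply=> //; rewrite /b; lia.
have [ri|ri] := eqVneq (cell_row y) (cell_row x).
  apply: single; first by move=> w; rewrite lt_leAnge !le_trapezoidE; lia.
  by rewrite /a ri subnn !Phi_0l // /b; lia.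
have bS : b = b.-1.+1 by rewrite /b; lia.
have [bd|bd] := eqVneq (cell_col y + cell_row y)%N s.
  apply: single.
    move=> w; have := cell_bounds w.
    by move=> [*]; rewrite lt_leAnge !le_trapezoidE; lia.
  by rewrite bS Phi_boundary // /a /b; lia.
have [||y1 [y1r y1c]] := row_step; [lia..|].
have xy1 : (x <= y1)%O by rewrite le_trapezoidE; lia.
(* The covers [(j + 1, d)] and [(j, d - 1)] meet in [(j + 1, d - 1)]. *)
have [|||z [zr zc]] := @cell_exists (cell_row y).+1 (cell_col y).-1; [lia..|].
have xz : (x <= z)%O by rewrite le_trapezoidE; lia.
have aS : a = a.-1.+1 by rewrite /a; lia.
rewrite -/a -/b aS bS Phi_rec; last by rewrite /a /b; lia.
apply: (@two_cover_numerator _ _ rho (aug_rankB_homo _) _ _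
          (aug_cell y1) (aug_cell y2) (aug_cell z)) => //.
- by apply: covE => //; lia.
- by case=> [w|] // xw; rewrite !le_aug_cellE; lia.
- by rewrite !rhoE // /a /b; lia.
- by rewrite !rhoE // /a /b; lia.
- by rewrite !rhoE // /a /b; lia.
- by rewrite !rhoE ?le_trapezoidE // /a /b; lia.
- have -> : a.-1 = (cell_row x - cell_row y1)%N by rewrite /a; lia.
  have -> : b.-1.+1 = (cell_col y1 - cell_col x)%N by rewrite /b; lia.
  by apply: IHn => //; lia.
- have -> : a.-1.+1 = (cell_row x - cell_row y2)%N by rewrite /a; lia.
  have -> : b.-1 = (cell_col y2 - cell_col x)%N by rewrite /b; lia.
  by apply: IHn => //; lia.
- have -> : a.-1 = (cell_row x - cell_row z)%N by rewrite /a; lia.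
  have -> : b.-1 = (cell_col z - cell_col x)%N by rewrite /b; lia.
  by apply: IHn => //; lia.
Qed.

Lemma bot_numerator :
  is_qzeta_numerator (closed_interval (@aug_bot r s) aug_bot) (@aug_rank r s) 1.
Proof. by apply: point_numerator; first exact: aug_rank_homo. Qed.

(** Induction on the rank of [y] up to a constant, written [d + (r - j)]. The bound [2 * r <= s]
    keeps [s - 2 * k] untruncated for [k <= r]. *)
Lemma bot_interval_numerator y : (2 * r <= s)%N ->
  is_qzeta_numerator (closed_interval aug_bot (aug_cell y)) (@aug_rank r s)
    (\sum_(cell_row y <= k < (minn r (cell_col y)).+1)
       Psi (k - cell_row y) (cell_col y - k) (s - 2 * k) (q *: 'X)).
Proof.
move=> rs; have [n] := ubnP (cell_col y + (r - cell_row y))%N.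
elim: n y => // n IHn y; rewrite ltnS => le_n.
have [r1' rr' rc' cs'] := cell_bounds y.
set j := cell_row y in le_n r1' rr' rc' cs' *.
set d := cell_col y in le_n rc' cs' *.
have rankE z : aug_rank (aug_cell z) = (cell_col z - cell_row z + 1)%N by [].
have botP (w : aug_trapezoid r s) : (aug_bot <= w)%O by [].
(* On the diagonal [y] is a minimal cell, covering only the bottom; the sum is its term [k = j],
   equal to 1. *)
have [dj|dj] := eqVneq d j.
  rewrite (_ : minn r d = j); last by lia.
  rewrite big_nat1 subnn /=.
  apply: (@single_cover_numerator _ _ _ (@aug_rank_homo) _ _ aug_bot) => //.
  - case=> [z|] // _; rewrite lt_leAnge le_aug_cellE.
    have [*] := cell_bounds z; apply/negbTE; rewrite le_aug_cellE -/d -/j; lia.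
  - by rewrite rankE -/d -/j dj subnn.
  - exact: bot_numerator.
have [||| y2 [y2r y2c]] := @cell_exists j d.-1; [lia..|].
have single : (forall w : trapezoid r s, (w < y)%O = (w <= y2)%O) ->
    \sum_(j <= k < (minn r d).+1) Psi (k - j) (d - k) (s - 2 * k) (q *: 'X) =
    \sum_(j <= k < (minn r d.-1).+1) Psi (k - j) (d.-1 - k) (s - 2 * k) (q *: 'X) ->
    is_qzeta_numerator (closed_interval aug_bot (aug_cell y)) (@aug_rank r s)
    (\sum_(j <= k < (minn r d).+1) Psi (k - j) (d - k) (s - 2 * k) (q *: 'X)).
  move=> cov ->.
  apply: (@single_cover_numerator _ _ _ (@aug_rank_homo) _ _ (aug_cell y2)) => //.
  - by case=> [z|] // _; have := cov z; rewrite !lt_leAnge.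
  - by rewrite !rankE y2c y2r -/d -/j; lia.
  - by have := IHn y2; rewrite y2r y2c; apply; lia.
have [jr|jr] := eqVneq j r.
  apply: single.
    move=> w; have := cell_bounds w.
    by move=> [*]; rewrite lt_leAnge !le_trapezoidE -/d -/j; lia.
  rewrite (_ : minn r d = j); last by lia.
  rewrite (_ : minn r d.-1 = j); last by lia.
  by rewrite !big_nat1 subnn.
have [bd|bd] := eqVneq (d + j)%N s.
  apply: single.
    move=> w; have := cell_bounds w.
    by move=> [*]; rewrite lt_leAnge !le_trapezoidE -/d -/j; lia.
  (* From [j < r] and [2 * r <= s] follows [d > r], so lowering [d] keeps the range of [k]; each
     term is a boundary case of [Psi]. *)
  rewrite (_ : minn r d = r); last by lia.
  rewrite (_ : minn r d.-1 = r); last by lia.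
  apply: eq_big_nat => k kr.
  rewrite (_ : d - k = (d.-1 - k).+1)%N; last by lia.
  by rewrite Psi_boundary //; lia.
have [||| y1 [y1r y1c]] := @cell_exists j.+1 d; [lia..|].
have H1 := IHn y1; have H2 := IHn y2.
rewrite y1r y1c in H1; rewrite y2r y2c in H2.
have {}H1 := H1 ltac:(lia); have {}H2 := H2 ltac:(lia).
have covE w : (w < aug_cell y)%O = (w <= aug_cell y1)%O || (w <= aug_cell y2)%O.
  case: w => [w|] //; rewrite lt_leAnge !le_aug_cellE -/j -/d; lia.
(* Next to the diagonal the covers [(j + 1, j + 1)] and [(j, j)] meet in the bottom element, and the
   sum is [1 + q t]. *)
have [dj1|dj1] := eqVneq d j.+1.
  have -> : \sum_(j <= k < (minn r d).+1) Psi (k - j) (d - k) (s - 2 * k) (q *: 'X)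
    = 1 + 1 - (1 - q ^+ 1 *: 'X) * 1 :> {poly Fq}.
    rewrite (_ : minn r d = j.+1); last by lia.
    rewrite big_ltn // big_nat1 subnn subSnn dj1 subnn Psi_0r //= expr1 mulr1.
    by rewrite opprB -[RHS]addrA; congr (_ + _); rewrite [RHS]addrC subrK.
  rewrite (_ : minn r d = j.+1) in H1; last by lia.
  rewrite (_ : minn r d.-1 = j) in H2; last by lia.
  rewrite big_nat1 subnn in H1; rewrite big_nat1 subnn in H2.
  apply: (@two_cover_numerator _ _ _ (@aug_rank_homo) _ _
            (aug_cell y1) (aug_cell y2) aug_bot) => //.
  + case=> [w|] // _; have [*] := cell_bounds w.
    by rewrite !le_aug_cellE; symmetry; apply/negbTE; lia.
  + by rewrite rankE; lia.
  + by rewrite rankE; lia.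
  + by rewrite rankE -/d -/j; lia.
  + exact: bot_numerator.
have [||| z [zr zc]] := @cell_exists j.+1 d.-1; [lia..|].
have := IHn z; rewrite zr zc => /(_ ltac:(lia)) H3.
have -> : \sum_(j <= k < (minn r d).+1) Psi (k - j) (d - k) (s - 2 * k) (q *: 'X)
  = \sum_(j.+1 <= k < (minn r d).+1) Psi (k - j.+1) (d - k) (s - 2 * k) (q *: 'X)
  + \sum_(j <= k < (minn r d.-1).+1) Psi (k - j) (d.-1 - k) (s - 2 * k) (q *: 'X)
  - (1 - q ^+ (d - j) *: 'X) *
    \sum_(j.+1 <= k < (minn r d.-1).+1) Psi (k - j.+1) (d.-1 - k) (s - 2 * k) (q *: 'X)
  :> {poly Fq}.
  (* The terms [k = j] are 1 and cancel; for larger [k] the recursion of [Psi] applies termwise. *)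
  rewrite (big_ltn (m := j)); last by lia.
  rewrite [X in _ = _ + X - _]big_ltn; last by lia.
  rewrite subnn /= addrCA -!addrA; congr (1 + _).
  have recE k : (j < k < (minn r d.-1).+1)%N ->
      Psi (k - j) (d - k) (s - 2 * k) (q *: 'X) =
      Psi (k - j.+1) (d - k) (s - 2 * k) (q *: 'X)
      + Psi (k - j) (d.-1 - k) (s - 2 * k) (q *: 'X)
      - (1 - q ^+ (d - j) *: 'X) *
          Psi (k - j.+1) (d.-1 - k) (s - 2 * k) (q *: 'X) :> {poly Fq}.
    move=> kd.
    rewrite (_ : k - j = (k - j.+1).+1)%N; last by lia.
    rewrite (_ : d - k = (d.-1 - k).+1)%N; last by lia.
    rewrite Psi_rec; last by lia.
    (* The argument [q *: 'X] contributes one more [q], raising the exponent to [d - j], the rank of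
       [y] minus 1. *)
    rewrite scalerA -exprSr (_ : (k - j.+1 + (d.-1 - k)).+2 = d - j)%N //; lia.
  (* If [d <= r], the sums for [d] have an index [k = d] absent from those for [d - 1]; both extra
     terms are [q t] because [d > j + 1]. *)
  case: (boolP (d <= r)%N) => rd.
    rewrite (_ : minn r d.-1 = d.-1) in recE *; last by lia.
    rewrite (_ : minn r d = d); last by lia.
    rewrite prednK; last by lia.
    rewrite big_nat_recr /=; last by lia.
    rewrite [X in _ = X + _]big_nat_recr /=; last by lia.
    rewrite subnn !Psi_0r; [|lia..].
    rewrite [RHS]addrAC; congr (_ + _).
    rewrite mulr_sumr addrA -big_split -sumrB /=.
    by apply: eq_big_nat => k kd; apply: recE; lia.
  rewrite (_ : minn r d.-1 = minn r d) in recE *; last by lia.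
  rewrite mulr_sumr addrA -big_split -sumrB /=.
  by apply: eq_big_nat => k kd; apply: recE; lia.
rewrite (_ : d - j = (d - j).-1.+1)%N; last by lia.
apply: (@two_cover_numerator _ _ _ (@aug_rank_homo) _ _
          (aug_cell y1) (aug_cell y2) (aug_cell z)) => //.
- case=> [w|] // _; rewrite !le_aug_cellE; lia.
- by rewrite rankE; lia.
- by rewrite rankE; lia.
- by rewrite rankE; lia.
- by rewrite rankE -/d -/j; lia.
Qed.
End Cells.

Theorem theorem4p5 (r s : nat) (hr : (1 <= r)%N) (hs : (2 * r <= s)%N) :
  [/\ forall y : trapezoid r s,
        let j := cell_row y in let d := cell_col y in let K := minn r d in
        is_qzeta_numerator (closed_interval aug_bot (aug_cell y))
          (@aug_rank r s)
          (\sum_(j <= k < K.+1) Psi (k - j) (d - k) (s - 2 * k) (q *: 'X)),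
      forall x y : trapezoid r s, (x <= y)%O ->
        let i := cell_row x in let c := cell_col x in
        let j := cell_row y in let d := cell_col y in
        is_qzeta_numerator (closed_interval (aug_cell x) (aug_cell y))
          (fun z => (aug_rank z - aug_rank (aug_cell x))%N)
          (Phi (i - j) (d - c) (s - i - c) 'X)
    & is_qzeta_numerator (closed_interval (@aug_bot r s) aug_bot)
        (@aug_rank r s) 1 ].
Proof.
split=> [y|x y xy|]; first exact: bot_interval_numerator.
  exact: cell_interval_numerator.
exact: bot_numerator.
Qed.
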